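(* Let $n,p,m,\nu\ge 1$ be integers and let $F:\mathbb{R}^n\to\mathbb{R}^n$, $H:\mathbb{R}^n\to\mathbb{R}^p$, $q:\mathbb{R}^n\to\mathbb{R}$, $E:\mathbb{R}^n\to\mathbb{R}^{n\times m}$, $K:\mathbb{R}^n\to\mathbb{R}^{p\times m}$ be smooth. Consider the system $$\frac{dx}{dt}=F(x)+E(x)W,\qquad y=H(x)+K(x)W,\qquad z=q(x),$$ with disturbance input $W\in\mathbb{R}^m$. Let $\lambda^\nu+\alpha_1\lambda^{\nu-1}+\cdots+\alpha_{\nu-1}\lambda+\alpha_\nu$ be a given polynomial with real coefficients, all of whose roots have negative real part. Then there exists a disturbance decoupled functional observer $$\frac{d\hat\xi}{dt}=A\hat\xi+By,\qquad \hat z=C\hat\xi+Dy,$$ with $A\in\mathbb{R}^{\nu\times\nu}$, $B\in\mathbb{R}^{\nu\times p}$, $C\in\mathbb{R}^{1\times\nu}$, $D\in\mathbb{R}^{1\times p}$, for this system such that the eigenvalues of $A$ (counted with multiplicity) are the roots of the given polynomial, if and only if there exist constant row vectors $\beta_0,\beta_1,\ldots,\beta_\nu\in\mathbb{R}^p$ (regarded as $1\times p$ matrices) such that the following two conditions hold for all $x\in\mathbb{R}^n$: (a) $$L_F^\nu q(x)+\alpha_1L_F^{\nu-1}q(x)+\cdots+\alpha_{\nu-1}L_Fq(x)+\alpha_\nu q(x)=L_F^\nu(\beta_0H(x))+L_F^{\nu-1}(\beta_1H(x))+\cdots+L_F(\beta_{\nu-1}H(x))+\beta_\nu H(x);$$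 (b) for every $\kappa=1,\ldots,\nu$, $$\sum_{\ell=0}^{\nu-\kappa}L_EL_F^{\nu-\kappa-\ell}(\beta_\ell H(x))+\beta_{\nu-\kappa+1}K(x)=L_EL_F^{\nu-\kappa}q(x)+\sum_{\ell=1}^{\nu-\kappa}\alpha_\ell L_EL_F^{\nu-\kappa-\ell}q(x),$$ and $\beta_0K(x)=0$.
   Context: Lie derivatives: for a smooth $h:\mathbb{R}^n\to\mathbb{R}$, $L_Fh(x)=\frac{\partial h}{\partial x}(x)F(x)=\sum_{k=1}^nF_k(x)\frac{\partial h}{\partial x_k}(x)$, $L_F^0h=h$, $L_F^{j}h=L_F(L_F^{j-1}h)$; and $L_Eh(x)=\frac{\partial h}{\partial x}(x)E(x)$, a $1\times m$ row vector. An empty sum is zero. Definition (disturbance decoupled functional observer). The system $\frac{d\hat\xi}{dt}=A\hat\xi+By$, $\hat z=C\hat\xi+Dy$, with $A,B,C,D$ constant real matrices of sizes $\nu\times\nu$, $\nu\times p$, $1\times\nu$, $1\times p$ and $A$ having stable eigenvalues (all with negative real part), is a disturbance decoupled functional observer for the system $\frac{dx}{dt}=F(x)+E(x)W$, $y=H(x)+K(x)W$, $z=q(x)$ if there exists a continuously differentiable mapping $T:\mathbb{R}^n\to\mathbb{R}^\nu$ such that for all $x\in\mathbb{R}^n$: (i) $\frac{\partial T}{\partial x}(x)F(x)=AT(x)+BH(x)$; (ii) $q(x)=CT(x)+DH(x)$; (iii) $-\frac{\partial T}{\partial x}(x)E(x)+BK(x)=0$; (iv) $DK(x)=0$. *)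

(* Defs.v *)
From mathcomp Require Import all_boot all_order all_algebra.
From mathcomp Require Import all_classical all_reals all_analysis.
From mathcomp Require Import complex.

Set Implicit Arguments.
Unset Strict Implicit.
Unset Printing Implicit Defensive.

Import Order.TTheory GRing.Theory Num.Theory.
Import numFieldNormedType.Exports.

Local Open Scope ring_scope.

Definition partial (R : realType) n (k : 'I_n) (h : 'cV[R]_n -> R)
  : 'cV[R]_n -> R := fun x => 'D_(delta_mx k 0) h x.

(* C^r: [differentiable] is Frechet differentiability, and C^(r+1) asks in
   addition that every partial derivative be C^r.  For r = 1 this is
   differentiability with continuous derivative. *)
Fixpoint Cr (R : realType) n (r : nat) (h : 'cV[R]_n -> R) : Prop :=
  if r is r'.+1 then
    (forall x, differentiable h x) /\ (forall k, Cr r' (partial k h))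
  else continuous h.

Definition Cr_mx (R : realType) n r a b (G : 'cV[R]_n -> 'M[R]_(a, b)) : Prop :=
  forall i j, Cr r (fun x => G x i j).

Definition smooth (R : realType) n (h : 'cV[R]_n -> R) : Prop :=
  forall r, Cr r h.

Definition smooth_mx (R : realType) n a b (G : 'cV[R]_n -> 'M[R]_(a, b)) : Prop :=
  forall r, Cr_mx r G.

Definition grad (R : realType) n (h : 'cV[R]_n -> R) (x : 'cV[R]_n) : 'rV[R]_n :=
  \row_k partial k h x.

(* The library's [jacobian] is for maps between row vectors and acts by right
   multiplication; here vectors are columns, and row i is the gradient of T_i. *)
Definition jac (R : realType) n r (T : 'cV[R]_n -> 'cV[R]_r) (x : 'cV[R]_n)
  : 'M[R]_(r, n) := \matrix_(i, k) partial k (fun y => T y i 0) x.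

Definition lie (R : realType) n (F : 'cV[R]_n -> 'cV[R]_n) (h : 'cV[R]_n -> R)
  : 'cV[R]_n -> R := fun x => \sum_(k < n) F x k 0 * partial k h x.

Definition lie_iter (R : realType) n (F : 'cV[R]_n -> 'cV[R]_n) (j : nat)
  (h : 'cV[R]_n -> R) : 'cV[R]_n -> R := iter j (lie F) h.

Definition lie_row (R : realType) n m (E : 'cV[R]_n -> 'M[R]_(n, m))
  (h : 'cV[R]_n -> R) : 'cV[R]_n -> 'rV[R]_m := fun x => grad h x *m E x.

Definition mx_complex (R : realType) a b (A : 'M[R]_(a, b)) : 'M[R[i]]_(a, b) :=
  map_mx (real_complex R) A.

Definition poly_complex (R : realType) (P : {poly R}) : {poly R[i]} :=
  map_poly (real_complex R) P.

Definition stable (R : realType) nu (A : 'M[R]_nu) : Prop :=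
  forall z : R[i], eigenvalue (mx_complex A) z -> complex.Re z < 0.

(* [mup z P] is the multiplicity of z as a root of P (0 if z is not a root);
   the multiplicity of an eigenvalue is its multiplicity as a root of the
   characteristic polynomial. *)
Definition eigenvalues_are_roots (R : realType) nu (A : 'M[R]_nu) (P : {poly R})
  : Prop :=
  forall z : R[i], mup z (char_poly (mx_complex A)) = mup z (poly_complex P).

Definition monic_of_coefs (R : realType) (nu : nat) (alpha : nat -> R) : {poly R} :=
  'X^nu + \sum_(1 <= l < nu.+1) alpha l *: 'X^(nu - l).

(* dx/dt = F x + E x W,  y = H x + K x W,  z = q x *)
Record dist_system (R : realType) (n m p : nat) := DistSystem {
  sysF : 'cV[R]_n -> 'cV[R]_n;
  sysE : 'cV[R]_n -> 'M[R]_(n, m);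
  sysH : 'cV[R]_n -> 'cV[R]_p;
  sysK : 'cV[R]_n -> 'M[R]_(p, m);
  sysq : 'cV[R]_n -> R
}.

Definition dd_functional_observer (R : realType) n m p nu
    (S : dist_system R n m p) (A : 'M[R]_nu) (B : 'M[R]_(nu, p))
    (C : 'rV[R]_nu) (D : 'rV[R]_p) : Prop :=
  stable A /\
  exists T : 'cV[R]_n -> 'cV[R]_nu,
    Cr_mx 1 T /\
    forall x,
      [/\ jac T x *m sysF S x = A *m T x + B *m sysH S x,
          sysq S x = (C *m T x + D *m sysH S x) 0 0,
          - (jac T x *m sysE S x) + B *m sysK S x = 0
        & D *m sysK S x = 0].

(* x |-> beta H(x), the 1 x 1 matrix read as a scalar *)
Definition row_output (R : realType) n p (b : 'rV[R]_p) (H : 'cV[R]_n -> 'cV[R]_p)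
  : 'cV[R]_n -> R := fun x => (b *m H x) 0 0.

(* Main.v *)
Require Import Defs.
From mathcomp Require Import all_boot all_order all_algebra.
From mathcomp Require Import all_classical all_reals all_analysis.
From mathcomp Require Import complex ring.

(** Put alpha_0 = 1, u_l = alpha_l q - beta_l H and
      g_j = L_F^j u_0 + L_F^(j-1) u_1 + ... + u_j,
    so that g_0 = q - beta_0 H and g_(j+1) = L_F g_j + alpha_(j+1) q -
    beta_(j+1) H.  Expanding the Lie derivatives by linearity, condition (a)
    says g_nu = 0, and condition (b) for kappa = nu - j says
    L_E g_j = beta_(j+1) K for j < nu, together with beta_0 K = 0
    ([conditions_lie_chain]).  In these terms both implications are statements
    about the finite chain g_0, ..., g_nu.

    If the conditions hold, substitute q = g_0 + beta_0 H in the recurrence: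
      L_F g_j = g_(j+1) - alpha_(j+1) g_0
                + (beta_(j+1) - alpha_(j+1) beta_0) H,   g_nu = 0.
    This is a linear system driven by y, in observer canonical form, so the
    g_j, taken in decreasing order of j, are the coordinates of T; the matrix is
    then the transposed companion matrix of the given polynomial
    ([observer_of_conditions]).  Having the roots of that polynomial as
    eigenvalues, with multiplicity, amounts to having it as characteristic
    polynomial ([char_poly_eigenvalues]).

    Conversely, let an observer with mapping T be given and let p_j be the
    Horner polynomials p_0 = 1, p_(j+1) = p_j X + alpha_(j+1), so that p_nu is
    the given polynomial.  With beta_0 = D and
    beta_(j+1) = C p_j(A) B + alpha_(j+1) D one gets g_j = C p_j(A) T by
    induction; the disturbance conditions follow from (iii) and (iv), and
    g_nu = C p_nu(A) T = 0 by Cayley-Hamilton, p_nu being the characteristic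
    polynomial of A ([conditions_of_observer]).  T is only C^1, which is enough
    because each g_j is differentiated once, as a linear combination of the
    coordinates of T, while the higher Lie derivatives only meet q and H. *)

Set Implicit Arguments.
Unset Strict Implicit.
Unset Printing Implicit Defensive.

Import Order.TTheory GRing.Theory Num.Theory.
Import numFieldNormedType.Exports.

Local Open Scope ring_scope.

(** * Calculus of C^r functions, gradients and Lie derivatives *)

Lemma partialD (R : realType) n (k : 'I_n) (f g : 'cV[R]_n -> R) x :
  differentiable f x -> differentiable g x ->
  partial k (fun y => f y + g y) x = partial k f x + partial k g x.
Proof. by move=> df dg; apply: deriveD; exact: diff_derivable. Qed.

Lemma partialM (R : realType) n (k : 'I_n) (f g : 'cV[R]_n -> R) x :
  differentiable f x -> differentiable g x ->
  partial k (fun y => f y * g y) x = f x * partial k g x + g x * partial k f x.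
Proof. by move=> df dg; apply: deriveM; exact: diff_derivable. Qed.

Lemma partial_cst (R : realType) n (k : 'I_n) (c : R) :
  partial k (fun=> c) = fun=> 0.
Proof. by apply/funext => x; exact: derive_cst. Qed.

Lemma Cr_diff (R : realType) n r (f : 'cV[R]_n -> R) x :
  Cr r.+1 f -> differentiable f x.
Proof. by case. Qed.

Lemma Cr_cst (R : realType) n r (c : R) : Cr r (fun _ : 'cV[R]_n => c).
Proof.
elim: r c => [|r IHr] c /=; first exact: cst_continuous.
split=> [x|k]; first exact: differentiable_cst.
by rewrite partial_cst.
Qed.

Lemma CrW (R : realType) n r (f : 'cV[R]_n -> R) : Cr r.+1 f -> Cr r f.
Proof.
elim: r f => [|r IHr] f [df pf].
  by move=> x; exact: differentiable_continuous.
by split=> // k; apply: IHr.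
Qed.

Lemma CrD (R : realType) n r (f g : 'cV[R]_n -> R) :
  Cr r f -> Cr r g -> Cr r (fun x => f x + g x).
Proof.
elim: r f g => [|r IHr] f g.
  by move=> cf cg x; exact: (cvgD (cf x) (cg x)).
move=> [df pf] [dg pg]; split=> [x|k]; first exact: differentiableD.
rewrite (_ : partial _ _ = fun x => partial k f x + partial k g x).
  exact: IHr (pf k) (pg k).
by apply/funext => x; rewrite partialD.
Qed.

(** The product rule for a partial derivative keeps f and g themselves as
    factors, so the induction needs that C^(r+1) functions are C^r. *)
Lemma CrM (R : realType) n r (f g : 'cV[R]_n -> R) :
  Cr r f -> Cr r g -> Cr r (fun x => f x * g x).
Proof.
elim: r f g => [|r IHr] f g.
  by move=> cf cg x; exact: (cvgM (cf x) (cg x)).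
move=> Cf Cg; have [df pf] := Cf; have [dg pg] := Cg.
split=> [x|k]; first exact: differentiableM.
rewrite (_ : partial _ _ =
  fun x => f x * partial k g x + g x * partial k f x).
  exact: CrD (IHr _ _ (CrW Cf) (pg k)) (IHr _ _ (CrW Cg) (pf k)).
by apply/funext => x; rewrite partialM.
Qed.

Lemma Cr_sum (R : realType) n r I (s : seq I) (f : I -> 'cV[R]_n -> R) :
  (forall i, Cr r (f i)) -> Cr r (fun x => \sum_(i <- s) f i x).
Proof.
move=> Cf; elim: s => [|i s IHs].
  rewrite (_ : (fun _ => _) = fun=> 0); first exact: Cr_cst.
  by apply/funext => x; rewrite big_nil.
rewrite (_ : (fun _ => _) = fun x => f i x + \sum_(j <- s) f j x).
  exact: CrD.
by apply/funext => x; rewrite big_cons.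
Qed.

Lemma partial_sum (R : realType) n (k : 'I_n) I (s : seq I)
    (f : I -> 'cV[R]_n -> R) x :
  (forall i, Cr 1 (f i)) ->
  partial k (fun y => \sum_(i <- s) f i y) x = \sum_(i <- s) partial k (f i) x.
Proof.
move=> Cf; elim: s => [|i s IHs].
  rewrite (_ : (fun _ => _) = fun=> 0) ?partial_cst ?big_nil//.
  by apply/funext => y; rewrite big_nil.
rewrite (_ : (fun _ => _) = fun y => f i y + \sum_(j <- s) f j y).
  rewrite partialD ?IHs ?big_cons//; first exact: (Cf i).1.
  by apply: (@Cr_diff _ _ 0); exact: Cr_sum.
by apply/funext => y; rewrite big_cons.
Qed.

Lemma partialZ (R : realType) n (k : 'I_n) (c : R) (f : 'cV[R]_n -> R) x :
  differentiable f x -> partial k (fun y => c * f y) x = c * partial k f x.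
Proof.
by move=> df; rewrite partialM ?partial_cst ?mulr0 ?addr0//.
Qed.

Lemma row_outputE (R : realType) n p (b : 'rV[R]_p) (G : 'cV[R]_n -> 'cV[R]_p) :
  row_output b G = fun x => \sum_i b 0 i * G x i 0.
Proof. by apply/funext => x; rewrite /row_output mxE. Qed.

Lemma Cr_row_output (R : realType) n p r (b : 'rV[R]_p)
    (G : 'cV[R]_n -> 'cV[R]_p) : Cr_mx r G -> Cr r (row_output b G).
Proof.
move=> CG; rewrite row_outputE; apply: Cr_sum => i.
by apply: CrM; [exact: Cr_cst|exact: CG].
Qed.

(** Only C^1 regularity of G is assumed: this is applied to the mapping T of
    an observer, which need not be smooth. *)
Lemma grad_row_output (R : realType) n p (b : 'rV[R]_p)
    (G : 'cV[R]_n -> 'cV[R]_p) x :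
  Cr_mx 1 G -> grad (row_output b G) x = b *m jac G x.
Proof.
move=> CG; apply/rowP => k; rewrite !mxE row_outputE partial_sum => [|i].
  by apply: eq_bigr => i _; rewrite partialZ ?mxE//; exact: (CG i 0).1.
by apply: CrM; [exact: Cr_cst|exact: CG].
Qed.

Lemma gradD (R : realType) n (f g : 'cV[R]_n -> R) x :
  Cr 1 f -> Cr 1 g -> grad (fun y => f y + g y) x = grad f x + grad g x.
Proof.
by move=> [df _] [dg _]; apply/rowP => k; rewrite !mxE partialD.
Qed.

Lemma gradZ (R : realType) n (c : R) (f : 'cV[R]_n -> R) x :
  Cr 1 f -> grad (fun y => c * f y) x = c *: grad f x.
Proof. by move=> [df _]; apply/rowP => k; rewrite !mxE partialZ. Qed.

Lemma grad_sum (R : realType) n I (s : seq I) (f : I -> 'cV[R]_n -> R) x :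
  (forall i, Cr 1 (f i)) ->
  grad (fun y => \sum_(i <- s) f i y) x = \sum_(i <- s) grad (f i) x.
Proof.
move=> Cf; apply/rowP => k; rewrite !mxE partial_sum// summxE.
by apply: eq_bigr => i _; rewrite mxE.
Qed.

Lemma lieE (R : realType) n (F : 'cV[R]_n -> 'cV[R]_n) h x :
  lie F h x = (grad h x *m F x) 0 0.
Proof. by rewrite mxE; apply: eq_bigr => k _; rewrite mxE mulrC. Qed.

Lemma lie_sum (R : realType) n (F : 'cV[R]_n -> 'cV[R]_n) I (s : seq I)
    (f : I -> 'cV[R]_n -> R) x :
  (forall i, Cr 1 (f i)) ->
  lie F (fun y => \sum_(i <- s) f i y) x = \sum_(i <- s) lie F (f i) x.
Proof.
move=> Cf; rewrite lieE grad_sum// mulmx_suml summxE.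
by apply: eq_bigr => i _; rewrite lieE.
Qed.

Lemma smooth_lie (R : realType) n (F : 'cV[R]_n -> 'cV[R]_n) h :
  smooth_mx F -> smooth h -> smooth (lie F h).
Proof.
move=> sF sh r; apply: Cr_sum => k; apply: CrM; first exact: sF.
by have [_ +] := sh r.+1; apply.
Qed.

Lemma smooth_lie_iter (R : realType) n (F : 'cV[R]_n -> 'cV[R]_n) j h :
  smooth_mx F -> smooth h -> smooth (lie_iter F j h).
Proof. by move=> sF sh; elim: j => // j IHj; exact: smooth_lie. Qed.

Lemma smooth_lin (R : realType) n (a b : R) (f g : 'cV[R]_n -> R) :
  smooth f -> smooth g -> smooth (fun x => a * f x + b * g x).
Proof.
move=> sf sg r.
by apply: CrD; apply: CrM; (apply: Cr_cst || apply: sf || apply: sg).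
Qed.

Lemma grad_lin (R : realType) n (a b : R) (f g : 'cV[R]_n -> R) x :
  Cr 1 f -> Cr 1 g ->
  grad (fun y => a * f y + b * g y) x = a *: grad f x + b *: grad g x.
Proof.
by move=> sf sg; rewrite gradD ?gradZ//; apply: CrM => //; exact: Cr_cst.
Qed.

Lemma lie_iterS (R : realType) n (F : 'cV[R]_n -> 'cV[R]_n) j h :
  lie_iter F j.+1 h = lie F (lie_iter F j h).
Proof. by []. Qed.

Lemma lie_iter_lin (R : realType) n (F : 'cV[R]_n -> 'cV[R]_n) j (a b : R) f g :
  smooth_mx F -> smooth f -> smooth g ->
  lie_iter F j (fun x => a * f x + b * g x) =
  fun x => a * lie_iter F j f x + b * lie_iter F j g x.
Proof.
move=> sF sf sg; elim: j => [|j IHj] //; rewrite !lie_iterS IHj.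
rewrite funeqE => x; rewrite lieE grad_lin; try exact: smooth_lie_iter.
rewrite mulmxDl -!scalemxAl mxE [X in X + _ = _]mxE [X in _ + X = _]mxE.
by rewrite -!lieE.
Qed.

(** * Polynomials and companion matrices *)

Lemma monic_of_coefs0 (R : realType) (alpha : nat -> R) :
  monic_of_coefs 0 alpha = 1.
Proof. by rewrite /monic_of_coefs big_geq// addr0 expr0. Qed.

(** The Horner recurrence, which is also the recurrence satisfied by the
    coefficients expressing the chain g_j in terms of T. *)
Lemma monic_of_coefsS (R : realType) j (alpha : nat -> R) :
  monic_of_coefs j.+1 alpha
  = monic_of_coefs j alpha * 'X + (alpha j.+1)%:P.
Proof.
rewrite /monic_of_coefs big_nat_recr//= subnn expr0 alg_polyC addrA mulrDl.
rewrite -exprSr mulr_suml; congr (_ + _ + _).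
apply: eq_big_nat => l /andP[_ lj].
by rewrite subSn// -scalerAl -exprSr.
Qed.

Lemma monic_of_coefs_neq0 (R : realType) j (alpha : nat -> R) :
  monic_of_coefs j alpha != 0.
Proof.
elim: j => [|j IHj]; first by rewrite monic_of_coefs0 oner_neq0.
by rewrite monic_of_coefsS -size_poly_eq0 size_MXaddC (negPf IHj).
Qed.

Lemma size_monic_of_coefs (R : realType) j (alpha : nat -> R) :
  size (monic_of_coefs j alpha) = j.+1.
Proof.
elim: j => [|j IHj]; first by rewrite monic_of_coefs0 size_poly1.
by rewrite monic_of_coefsS size_MXaddC (negPf (monic_of_coefs_neq0 _ _)) IHj.
Qed.

Lemma coef_monic_of_coefs (R : realType) j i (alpha : nat -> R) :
  (i < j)%N -> (monic_of_coefs j alpha)`_i = alpha (j - i)%N.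
Proof.
elim: j i => // j IHj [|i] ij; rewrite monic_of_coefsS coefD coefMX coefC /=.
  by rewrite add0r subn0.
by rewrite addr0 IHj// subSS.
Qed.

Lemma monic_of_coefs_monic (R : realType) j (alpha : nat -> R) :
  monic_of_coefs j alpha \is monic.
Proof.
rewrite monicE lead_coefE size_monic_of_coefs /=.
elim: j => [|j IHj]; first by rewrite monic_of_coefs0 coef1.
by rewrite monic_of_coefsS coefD coefMX coefC addr0.
Qed.

Lemma char_poly_tr (R : comNzRingType) n (A : 'M[R]_n) :
  char_poly A^T = char_poly A.
Proof.
rewrite /char_poly -det_tr; congr (\det _).
by rewrite /char_poly_mx linearB /= tr_scalar_mx -map_trmx trmxK.
Qed.

(** Over an algebraically closed field a monic polynomial is the product of its
    linear factors, and the multiplicities count each factor. *)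
Lemma eq_mup_monic (F : closedFieldType) (p q : {poly F}) :
  p \is monic -> q \is monic -> (forall z, mup z p = mup z q) -> p = q.
Proof.
have [s ->] := closed_field_poly_normal p.
have [t ->] := closed_field_poly_normal q.
rewrite !monicE => /eqP + /eqP.
rewrite !lead_coefZ !(monicP (monic_prod_XsubC _ _ _)) !mulr1 => -> ->.
rewrite !scale1r => eq_mu; apply: perm_big; apply/allP => z _ /=.
by rewrite -!mu_prod_XsubC eq_mu.
Qed.

Lemma char_poly_eigenvalues (R : realType) nu (A : 'M[R]_nu) (P : {poly R}) :
  P \is monic -> eigenvalues_are_roots A P <-> char_poly A = P.
Proof.
move=> mP; rewrite /eigenvalues_are_roots /mx_complex -map_char_poly.
split=> [eq_mu|-> //].
apply: (@map_poly_inj _ _ (real_complex R)); apply: eq_mup_monic => //.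
- by rewrite map_monic char_poly_monic.
- by rewrite map_monic.
Qed.

(** Observer canonical form: the action is that of a transposed companion
    matrix on the reversed vector (h_nu, ..., h_0), so it computes the
    right-hand side of the recurrence of the chain.  The condition h_(nu+1) = 0 makes the
    first row, where the shift has no predecessor, follow the same formula. *)
Lemma observer_matrix (R : realType) nu (alpha : nat -> R) :
  exists A : 'M[R]_nu.+1, char_poly A = monic_of_coefs nu.+1 alpha /\
  forall h : nat -> R, h nu.+1 = 0 -> forall i : 'I_nu.+1,
    (A *m \col_k h (nu - k)%N) i 0
    = h (nu.+1 - i)%N - alpha (nu.+1 - i)%N * h 0%N.
Proof.
set P := monic_of_coefs _ _.
pose A : 'M[R]_nu.+1 :=
  \matrix_(i, k) if k == nu :> nat then - P`_i else (k.+1 == i :> nat)%:R.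
exists A; split.
  rewrite -char_poly_tr -[RHS](companionmxK (monic_of_coefs_monic _ _)).
  rewrite -/P /companionmx.
  have -> : (size P).-1 = nu.+1 by rewrite size_monic_of_coefs.
  by congr char_poly; apply/matrixP => i j; rewrite !mxE.
move=> h hnu i; rewrite mxE big_ord_recr /= !mxE /= eqxx subnn.
rewrite coef_monic_of_coefs// mulNr; congr (_ - _).
have [i0|i0] := posnP i.
  rewrite i0 subn0 hnu big1// => k _; rewrite !mxE /= ltn_eqF ?i0 ?mul0r//.
have ltin : (i.-1 < nu)%N by rewrite -ltnS prednK.
rewrite (bigD1 (Ordinal ltin))//= !mxE /= ltn_eqF// prednK// eqxx mul1r.
rewrite big1 ?addr0 => [|k ki].
  by congr h; rewrite -[in RHS](prednK i0) subSS.
rewrite !mxE /= ltn_eqF//; case: eqP => [ik|]; last by rewrite mul0r.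
by case/negP: ki; apply/eqP/val_inj; rewrite /= -ik.
Qed.

(** * The chain of iterated Lie derivatives *)

Definition lie_chain (R : realType) n (F : 'cV[R]_n -> 'cV[R]_n)
    (u : nat -> 'cV[R]_n -> R) j : 'cV[R]_n -> R :=
  fun x => \sum_(0 <= l < j.+1) lie_iter F (j - l) (u l) x.

Lemma smooth_lie_chain (R : realType) n (F : 'cV[R]_n -> 'cV[R]_n) u j :
  smooth_mx F -> (forall l, smooth (u l)) -> smooth (lie_chain F u j).
Proof. by move=> sF su r; apply: Cr_sum => l; exact: smooth_lie_iter. Qed.

Lemma lie_chain0 (R : realType) n (F : 'cV[R]_n -> 'cV[R]_n) u :
  lie_chain F u 0 = u 0%N.
Proof. by rewrite funeqE => x; rewrite /lie_chain big_nat1. Qed.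

(** One application of L_F raises every exponent by one; the only new term has
    exponent zero. *)
Lemma lie_chainS (R : realType) n (F : 'cV[R]_n -> 'cV[R]_n) u j x :
  smooth_mx F -> (forall l, smooth (u l)) ->
  lie_chain F u j.+1 x = lie F (lie_chain F u j) x + u j.+1 x.
Proof.
move=> sF su; rewrite [LHS]big_nat_recr//= subnn; congr (_ + _).
rewrite lie_sum => [|l]; last exact: smooth_lie_iter.
by apply: eq_big_nat => l /andP[_ lj]; rewrite subSn.
Qed.

(** The coefficient of q is that of the monic polynomial, whose leading
    coefficient 1 is not an entry of alpha.  The difference is written as a
    linear combination so that [lie_iter_lin] applies to it. *)
Definition chain_input (R : realType) n p (alpha : nat -> R)
    (beta : nat -> 'rV[R]_p) (q : 'cV[R]_n -> R) (H : 'cV[R]_n -> 'cV[R]_p) l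
  : 'cV[R]_n -> R :=
  fun x => (if l is 0 then 1 else alpha l) * q x + -1 * row_output (beta l) H x.

Section Chain.
Variables (R : realType) (n p m : nat).
Variables (F : 'cV[R]_n -> 'cV[R]_n) (H : 'cV[R]_n -> 'cV[R]_p).
Variables (q : 'cV[R]_n -> R) (E : 'cV[R]_n -> 'M[R]_(n, m)).
Variables (alpha : nat -> R) (beta : nat -> 'rV[R]_p).
Hypotheses (smF : smooth_mx F) (smH : smooth_mx H) (smq : smooth q).

Let u := chain_input alpha beta q H.

Lemma smooth_row_output l : smooth (row_output (beta l) H).
Proof. by move=> r; exact: Cr_row_output. Qed.

Lemma smooth_chain_input l : smooth (u l).
Proof. exact: smooth_lin smq (smooth_row_output l). Qed.

Lemma lie_chain_input j x :
  lie_chain F u j x =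
  lie_iter F j q x + \sum_(1 <= l < j.+1) alpha l * lie_iter F (j - l) q x
  - \sum_(0 <= l < j.+1) lie_iter F (j - l) (row_output (beta l) H) x.
Proof.
rewrite -sumrN /lie_chain.
under eq_bigr => l _ do
  rewrite (lie_iter_lin _ _ _ smF smq (smooth_row_output l)) mulN1r.
rewrite big_split /= [X in X + _ = _]big_ltn// subn0 mul1r; congr (_ + _ + _).
by apply: eq_big_nat => -[].
Qed.

Lemma lie_row_chain_input j x :
  lie_row E (lie_chain F u j) x =
  lie_row E (lie_iter F j q) x
  + \sum_(1 <= l < j.+1) alpha l *: lie_row E (lie_iter F (j - l) q) x
  - \sum_(0 <= l < j.+1)
      lie_row E (lie_iter F (j - l) (row_output (beta l) H)) x.
Proof.
have sb k l : smooth (lie_iter F k (row_output (beta l) H)).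
  by apply: smooth_lie_iter => //; exact: smooth_row_output.
have sq k : smooth (lie_iter F k q) by exact: smooth_lie_iter.
rewrite /lie_row grad_sum => [|l]; last first.
  by apply: smooth_lie_iter => //; exact: smooth_chain_input.
rewrite mulmx_suml -sumrN.
under eq_bigr => l _.
  rewrite (lie_iter_lin _ _ _ smF smq (smooth_row_output l)).
  rewrite grad_lin; [|exact: sq|exact: sb].
  rewrite mulmxDl -!scalemxAl scaleN1r; over.
rewrite big_split /= [X in X + _ = _]big_ltn// subn0 scale1r; congr (_ + _ + _).
by apply: eq_big_nat => -[].
Qed.

(** With j = nu - kappa, condition (b) is the expansion of
    L_E g_j = beta_(j+1) K, and (a) is the expansion of g_nu = 0. *)
Lemma conditions_lie_chain nu (K : 'cV[R]_n -> 'M[R]_(p, m)) x :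
  [/\ lie_iter F nu q x
            + \sum_(1 <= l < nu.+1) alpha l * lie_iter F (nu - l) q x
          = \sum_(0 <= l < nu.+1) lie_iter F (nu - l) (row_output (beta l) H) x,
          forall kappa : nat, (1 <= kappa <= nu)%N ->
            \sum_(0 <= l < (nu - kappa).+1)
                lie_row E (lie_iter F (nu - kappa - l) (row_output (beta l) H)) x
              + beta (nu - kappa + 1)%N *m K x
            = lie_row E (lie_iter F (nu - kappa) q) x
              + \sum_(1 <= l < (nu - kappa).+1)
                  alpha l *: lie_row E (lie_iter F (nu - kappa - l) q) x
        & beta 0%N *m K x = 0]
  <->
  [/\ lie_chain F u nu x = 0,
      forall j, (j < nu)%N -> lie_row E (lie_chain F u j) x = beta j.+1 *m K x
    & beta 0%N *m K x = 0].
Proof.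
rewrite lie_chain_input; split=> -[ha hb h0]; split=> //.
- by rewrite ha subrr.
- move=> j jnu; rewrite lie_row_chain_input.
  have := hb (nu - j)%N; rewrite subn_gt0 jnu leq_subr subKn 1?ltnW// addn1.
  by move=> <- //; rewrite addrC addKr.
- exact/subr0_eq.
- move=> k /andP[k0 knu]; have jnu : (nu - k < nu)%N.
    by rewrite ltn_subrL k0 (leq_trans k0).
  rewrite addn1 -(hb _ jnu) lie_row_chain_input.
  by rewrite addrC subrK.
Qed.

End Chain.

(** * Observers *)

Lemma row_outputBZ (R : realType) n p (a : R) (b c : 'rV[R]_p)
    (H : 'cV[R]_n -> 'cV[R]_p) x :
  row_output (b - a *: c) H x = row_output b H x - a * row_output c H x.
Proof.
rewrite /row_output mulmxBl -scalemxAl mxE [X in _ + X = _]mxE.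
by rewrite [X in _ - X = _]mxE.
Qed.

Lemma row_jac (R : realType) n r (T : 'cV[R]_n -> 'cV[R]_r) x i :
  row i (jac T x) = grad (fun y => T y i 0) x.
Proof. by apply/rowP => k; rewrite !mxE. Qed.

(** The coordinates of T are the chain in reverse order, g_(nu) first and g_0
    last, as the companion form of A requires; C reads off g_0. *)
Lemma observer_of_conditions (R : realType) (n p m nu : nat)
    (F : 'cV[R]_n -> 'cV[R]_n) (H : 'cV[R]_n -> 'cV[R]_p) (q : 'cV[R]_n -> R)
    (E : 'cV[R]_n -> 'M[R]_(n, m)) (K : 'cV[R]_n -> 'M[R]_(p, m))
    (alpha : nat -> R) (beta : nat -> 'rV[R]_p) (A : 'M[R]_nu.+1)
    (g := lie_chain F (chain_input alpha beta q H)) :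
  smooth_mx F -> smooth_mx H -> smooth q ->
  (forall h : nat -> R, h nu.+1 = 0 -> forall i : 'I_nu.+1,
    (A *m \col_k h (nu - k)%N) i 0
    = h (nu.+1 - i)%N - alpha (nu.+1 - i)%N * h 0%N) ->
  (forall x, [/\ g nu.+1 x = 0,
      forall j, (j < nu.+1)%N -> lie_row E (g j) x = beta j.+1 *m K x
    & beta 0%N *m K x = 0]) ->
  stable A ->
  exists B C D, dd_functional_observer (DistSystem F E H K q) A B C D.
Proof.
move=> smF smH smq HA hg stA.
pose B : 'M[R]_(nu.+1, p) :=
  \matrix_(i < nu.+1) (beta (nu - i).+1 - alpha (nu - i).+1 *: beta 0%N).
exists B, (delta_mx 0 ord_max), (beta 0%N); split=> //=.
pose T (x : 'cV[R]_n) : 'cV[R]_nu.+1 := \col_i g (nu - i)%N x.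
have su l : smooth (chain_input alpha beta q H l) by exact: smooth_chain_input.
have TE (i : 'I_nu.+1) j : (fun x => T x i j) = g (nu - i)%N.
  by rewrite funeqE => x; rewrite mxE.
exists T; split=> [i j|x]; first by rewrite TE; exact: smooth_lie_chain.
have g0 : g 0%N x = q x - row_output (beta 0%N) H x.
  by rewrite /g lie_chain0 /chain_input mul1r mulN1r.
have [gnu gE bK0] := hg x; split=> //.
- apply/colP => i.
  (* Row i is the recurrence of the chain at j = nu - i, with q replaced by
     g_0 + beta_0 H. *)
  transitivity (lie F (g (nu - i)%N) x).
    by rewrite lieE -(TE i 0) -row_jac -row_mul [RHS]mxE.
  rewrite [RHS]mxE (HA (fun j => g j x))// g0 subSn -1?ltnS//.
  have -> : (B *m H x) i 0 = (row i B *m H x) 0 0 by rewrite -row_mul [RHS]mxE.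
  rewrite rowK -/(row_output _ H x) row_outputBZ.
  rewrite /g lie_chainS// /chain_input; ring.
- rewrite -rowE [LHS](_ : _ = g 0%N x + row_output (beta 0%N) H x).
    by rewrite mxE; congr (_ + _); rewrite !mxE subnn.
  by rewrite g0 subrK.
- apply/row_matrixP => i; rewrite linearD linearN /= !row_mul row_jac.
  rewrite TE rowK -/(lie_row _ _ _) gE ?ltnS ?leq_subr// mulmxBl -scalemxAl bK0.
  by rewrite scaler0 subr0 addNr linear0.
Qed.

(** The induction g_j = C p_j(A) T turns one Lie derivative into one
    multiplication by A; the output term C p_j(A) B H that this creates, and the
    term alpha_(j+1) D H coming from q = C T + D H, are what beta_(j+1)
    cancels. *)
Lemma conditions_of_observer (R : realType) (n p m nu : nat)
    (F : 'cV[R]_n -> 'cV[R]_n) (H : 'cV[R]_n -> 'cV[R]_p) (q : 'cV[R]_n -> R)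
    (E : 'cV[R]_n -> 'M[R]_(n, m)) (K : 'cV[R]_n -> 'M[R]_(p, m))
    (alpha : nat -> R)
    (A : 'M[R]_nu.+1) (B : 'M[R]_(nu.+1, p)) (C : 'rV[R]_nu.+1) (D : 'rV[R]_p) :
  smooth_mx F -> smooth_mx H -> smooth q ->
  dd_functional_observer (DistSystem F E H K q) A B C D ->
  char_poly A = monic_of_coefs nu.+1 alpha ->
  exists beta : nat -> 'rV[R]_p,
  let g := lie_chain F (chain_input alpha beta q H) in
  forall x, [/\ g nu.+1 x = 0,
      forall j, (j < nu.+1)%N -> lie_row E (g j) x = beta j.+1 *m K x
    & beta 0%N *m K x = 0].
Proof.
move=> smF smH smq [_ [T [C1T /= obs]]] pA.
pose Gam j := C *m horner_mx A (monic_of_coefs j alpha).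
pose beta l := if l is j.+1 then Gam j *m B + alpha j.+1 *: D else D.
exists beta => /=; set g := lie_chain _ _.
have su l : smooth (chain_input alpha beta q H l) by exact: smooth_chain_input.
have gE j : g j = row_output (Gam j) T.
  elim: j => [|j IHj]; rewrite funeqE => x; have [T1 T2 T3 T4] := obs x.
    rewrite /g lie_chain0 /chain_input mul1r mulN1r T2 /Gam monic_of_coefs0.
    by rewrite rmorph1 mulmx1 mxE addrK.
  rewrite /g lie_chainS// -/g IHj lieE grad_row_output// -mulmxA T1.
  rewrite /chain_input T2 /row_output /= /Gam monic_of_coefsS -/(Gam j).
  rewrite rmorphD rmorphM /= horner_mx_X horner_mx_C.
  rewrite -mulmxE [in RHS]mulmxDr [in RHS]mulmxA mul_mx_scalar.
  rewrite -/(Gam j) !mulmxDl !mulmxDr -!mulmxA.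
  rewrite -!scalemxAl !mxE; ring.
move=> x; have [T1 T2 T3 T4] := obs x; split=> //.
  by rewrite gE /Gam -pA Cayley_Hamilton mulmx0 /row_output mul0mx mxE.
move=> j _; rewrite gE /lie_row grad_row_output// -mulmxA mulmxDl -mulmxA.
rewrite -scalemxAl T4 scaler0 addr0; congr (_ *m _).
by apply/esym/subr0_eq; rewrite addrC.
Qed.

Theorem proposition2 (R : realType) (n p m nu : nat)
    (hn : (1 <= n)%N) (hp : (1 <= p)%N) (hm : (1 <= m)%N) (hnu : (1 <= nu)%N)
    (F : 'cV[R]_n -> 'cV[R]_n) (H : 'cV[R]_n -> 'cV[R]_p) (q : 'cV[R]_n -> R)
    (E : 'cV[R]_n -> 'M[R]_(n, m)) (K : 'cV[R]_n -> 'M[R]_(p, m))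
    (smF : smooth_mx F) (smH : smooth_mx H) (smq : smooth q)
    (smE : smooth_mx E) (smK : smooth_mx K)
    (alpha : nat -> R)
    (halpha : forall z : R[i],
       root (poly_complex (monic_of_coefs nu alpha)) z -> complex.Re z < 0) :
  (exists (A : 'M[R]_nu) (B : 'M[R]_(nu, p)) (C : 'rV[R]_nu) (D : 'rV[R]_p),
      dd_functional_observer (DistSystem F E H K q) A B C D /\
      eigenvalues_are_roots A (monic_of_coefs nu alpha))
  <->
  (exists beta : nat -> 'rV[R]_p,
      forall x : 'cV[R]_n,
      [/\ lie_iter F nu q x
            + \sum_(1 <= l < nu.+1) alpha l * lie_iter F (nu - l) q x
          = \sum_(0 <= l < nu.+1) lie_iter F (nu - l) (row_output (beta l) H) x,
          forall kappa : nat, (1 <= kappa <= nu)%N ->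
            \sum_(0 <= l < (nu - kappa).+1)
                lie_row E (lie_iter F (nu - kappa - l) (row_output (beta l) H)) x
              + beta (nu - kappa + 1)%N *m K x
            = lie_row E (lie_iter F (nu - kappa) q) x
              + \sum_(1 <= l < (nu - kappa).+1)
                  alpha l *: lie_row E (lie_iter F (nu - kappa - l) q) x
        & beta 0%N *m K x = 0]).
Proof.
case: nu hnu halpha => [//|nu] _ halpha.
split=> [[A [B [C [D [obs /char_poly_eigenvalues pA]]]]]|[beta hbeta]].
  have [|beta hbeta] := conditions_of_observer smF smH smq obs (alpha := alpha).
    exact/pA/monic_of_coefs_monic.
  by exists beta => x; apply/conditions_lie_chain.
have [A [pA HA]] := observer_matrix nu alpha.
have stA : stable A.
  move=> z; rewrite eigenvalue_root_char /mx_complex -map_char_poly pA.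
  exact: halpha.
have hg x :=
  (conditions_lie_chain E alpha beta smF smH smq nu.+1 K x).1 (hbeta x).
have [B [C [D obs]]] := observer_of_conditions smF smH smq HA hg stA.
exists A, B, C, D; split=> //.
exact/char_poly_eigenvalues/pA/monic_of_coefs_monic.
Qed.
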